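(* Let $\mathcal{A}$ be a Banach algebra such that $\mathrm{rad}(\mathcal{A})=\mathrm{rann}(\mathcal{A})$ and the quotient algebra $\mathcal{A}/\mathrm{rad}(\mathcal{A})$ is commutative. Let $d$ be a derivation of $\mathcal{A}$ (not assumed bounded). Then $d(\mathcal{A})\subseteq \mathrm{rad}(\mathcal{A})$.
   Context: $\mathrm{rad}(\mathcal{A})$ is the Jacobson radical of $\mathcal{A}$, and $\mathrm{rann}(\mathcal{A})=\{c\in\mathcal{A}: ac=0 \text{ for all } a\in\mathcal{A}\}$ is the right annihilator of $\mathcal{A}$. A derivation of $\mathcal{A}$ is a linear map $d:\mathcal{A}\to\mathcal{A}$ with $d(ab)=d(a)b+ad(b)$ for all $a,b\in\mathcal{A}$. *)

(* Defs.v *)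
From mathcomp Require Import all_boot all_order all_algebra.
From mathcomp Require Import all_classical all_reals all_analysis.
From mathcomp Require Import complex.
Set Implicit Arguments. Unset Strict Implicit. Unset Printing Implicit Defensive.
Import Order.TTheory GRing.Theory Num.Theory.
Import numFieldNormedType.Exports.
Local Open Scope ring_scope.
Local Open Scope classical_set_scope.

Section BanachAlgebra.
Variables (R : realType) (V : completeNormedModType R[i]) (mul : V -> V -> V).

Definition banach_algebra_mul : Prop :=
  [/\ (forall a b c, mul (mul a b) c = mul a (mul b c)),
      (forall a b c, mul (a + b) c = mul a c + mul b c),
      (forall a b c, mul a (b + c) = mul a b + mul a c),
      (forall (l : R[i]) a b, mul (l *: a) b = l *: mul a b
                              /\ mul a (l *: b) = l *: mul a b)
    & (forall a b, `|mul a b| <= `|a| * `|b|)].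

Definition quasi_invertible (x : V) : Prop :=
  exists y, x + y - mul x y = 0 /\ x + y - mul y x = 0.

(* Jacobson radical (valid for non-unital algebras: rad A = A ∩ rad(A^#)):
   x ∈ rad A iff 1 - (l + a) x is invertible in the unitization A^# for all
   l ∈ C, a ∈ A, i.e. l x + a x is quasi-invertible in A. *)
Definition jacobson_radical : set V :=
  [set x | forall (l : R[i]) (a : V), quasi_invertible (l *: x + mul a x)].

Definition right_annihilator : set V := [set c | forall a, mul a c = 0].

Definition derivation (d : V -> V) : Prop :=
  (forall (l : R[i]) a b, d (l *: a + b) = l *: d a + d b) /\
  (forall a b, d (mul a b) = mul (d a) b + mul a (d b)).

End BanachAlgebra.

(* Main.v *)
(* The radical is an ideal stable under d, and right multiplications commute, as
   a b c = a c b. Let S be the separating space of d. A gliding hump argument shows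
   that, if S is not contained in the radical, some multiplier p is minimal: for
   every multiplier q, either q p S lies in the radical or q p S is dense in p S.
   An element of p S that is not quasi-invertible is then an identity for p S modulo
   the radical; it yields an exact idempotent e in S, and by minimality and the
   Gelfand-Mazur theorem e V is one-dimensional. Hence e d = 0, so e S = 0, which
   contradicts e in S. Therefore S lies in the radical, so d is bounded modulo the
   radical, and the Kleinecke-Shirokov argument makes right multiplication by d c
   quasi-nilpotent: its n-th power is, up to 1/n!, the n-fold commutator of d^n with
   right multiplication by c. *)

Require Import Defs.
From HB Require Import structures.
From mathcomp Require Import all_boot all_order all_algebra.
From mathcomp Require Import all_classical all_reals all_analysis.
From mathcomp Require Import complex ring lra.
Set Implicit Arguments. Unset Strict Implicit. Unset Printing Implicit Defensive.
Import Order.TTheory GRing.Theory Num.Theory.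
Import numFieldNormedType.Exports.
Local Open Scope ring_scope.
Local Open Scope classical_set_scope.

(** * Identities in abelian groups, decided by reflection *)

Inductive zterm := ZVar of nat | ZZero | ZAdd of zterm & zterm | ZOpp of zterm.

Fixpoint zeval (V : zmodType) (env : seq V) t : V :=
  match t with
  | ZVar i => env`_i
  | ZZero => 0
  | ZAdd t u => zeval env t + zeval env u
  | ZOpp t => - zeval env t
  end.

Fixpoint zcoef t (i : nat) : int :=
  match t with
  | ZVar j => (i == j)%:R
  | ZZero => 0
  | ZAdd t u => zcoef t i + zcoef u i
  | ZOpp t => - zcoef t i
  end.

Lemma zevalE (V : zmodType) (env : seq V) t :
  zeval env t = \sum_(i < size env) env`_i *~ zcoef t i.
Proof.
elim: t => [j||t IHt u IHu|t IHt] /=.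
- have [jn|nj] := ltnP j (size env).
    rewrite (bigD1 (Ordinal jn)) //= eqxx mulr1z big1 ?addr0 // => i ij.
    by rewrite (_ : (i == j :> nat) = false) ?mulr0z //; apply: negbTE.
  rewrite nth_default // big1 // => i _.
  by rewrite ltn_eqF ?mulr0z // (leq_trans (ltn_ord i)).
- by rewrite big1.
- by rewrite IHt IHu -big_split; apply: eq_bigr => i _; rewrite mulrzDr.
- by rewrite IHt -sumrN; apply: eq_bigr => i _; rewrite mulrNz.
Qed.

Lemma zeval_eq (V : zmodType) (env : seq V) t u :
  all (fun i => zcoef t i == zcoef u i) (iota 0 (size env)) ->
  zeval env t = zeval env u.
Proof.
move=> /allP tu; rewrite !zevalE; apply: eq_bigr => i _.
by rewrite (eqP (tu i _)) ?mem_iota ?add0n ?ltn_ord.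
Qed.

(* Atoms are compared by unification: rewriting may leave convertible but
   syntactically distinct structure instances inside them. *)
Ltac zindex x env :=
  lazymatch env with
  | ?y :: ?e =>
    match goal with
    | _ => let _ := match goal with _ => unify x y end in constr:(0%N)
    | _ => let n := zindex x e in constr:(n.+1)
    end
  end.

Ltac zatoms t env :=
  lazymatch t with
  | (?a + ?b)%R => let env := zatoms a env in zatoms b env
  | (- ?a)%R => zatoms a env
  | 0%R => env
  | _ => match env with
         | _ => let _ := zindex t env in env
         | _ => constr:(@cons _ t env)
         end
  end.

Ltac zreify t env :=
  lazymatch t with
  | (?a + ?b)%R => let a := zreify a env in let b := zreify b env in constr:(ZAdd a b)
  | (- ?a)%R => let a := zreify a env in constr:(ZOpp a)
  | 0%R => constr:(ZZero)
  | _ => let n := zindex t env in constr:(ZVar n)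
  end.

(** [V] is only a module and [mul] is no ring product, so [ring] does not apply; products and
    scalings are treated as atoms. *)
Ltac abel :=
  lazymatch goal with
  | |- @eq ?T ?a ?b =>
    let env := zatoms a (@nil T) in let env := zatoms b env in
    let ta := zreify a env in let tb := zreify b env in
    change (@zeval _ env ta = @zeval _ env tb); apply: zeval_eq; vm_compute; reflexivity
  end.

(** * Real-valued norm and completeness *)

Section RealNorm.
Variables (R : realType) (V : normedModType R[i]).
Implicit Types (x y : V).

(** The norm takes values in [R[i]]; its real part lives in a totally ordered field, where [lra] and
    [nra] work. *)
Definition rnorm x : R := complex.Re `|x|.

Lemma rnormE x : `|x| = (rnorm x)%:C%C.
Proof. by rewrite /rnorm RRe_real // normr_real. Qed.

Lemma rnorm_ge0 x : 0 <= rnorm x.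
Proof. by rewrite -ler0c -rnormE normr_ge0. Qed.

Lemma rnorm0 : rnorm (0 : V) = 0.
Proof. by rewrite /rnorm normr0. Qed.

Lemma rnorm_eq0 x : rnorm x = 0 -> x = 0.
Proof. by move=> x0; apply/normr0_eq0; rewrite rnormE x0. Qed.

Lemma rnormN x : rnorm (- x) = rnorm x.
Proof. by rewrite /rnorm normrN. Qed.

Lemma rnormB x y : rnorm (x - y) = rnorm (y - x).
Proof. by rewrite -rnormN opprB. Qed.

Lemma ler_rnormD x y : rnorm (x + y) <= rnorm x + rnorm y.
Proof. by rewrite -lecR rmorphD /= -!rnormE ler_normD. Qed.

Lemma ler_rnormB x y : rnorm (x - y) <= rnorm x + rnorm y.
Proof. by rewrite (le_trans (ler_rnormD _ _)) // rnormN. Qed.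

Lemma ler_rdist x y z : rnorm (x - z) <= rnorm (x - y) + rnorm (y - z).
Proof. by rewrite -[x - z](subrKA y) ler_rnormD. Qed.

Lemma rnormZ (l : R[i]) x : rnorm (l *: x) = Normc.normc l * rnorm x.
Proof.
apply: (@complexI R); rewrite rmorphM /= -!rnormE normrZ.
by congr (_ * _); case: l => a b; rewrite normc_def.
Qed.

Lemma normc_real (r : R) : 0 <= r -> Normc.normc r%:C%C = r.
Proof. by move=> r0; rewrite /= expr0n addr0 sqrtr_sqr ger0_norm. Qed.

Lemma rnormZr (r : R) x : 0 <= r -> rnorm (r%:C%C *: x) = r * rnorm x.
Proof. by move=> r0; rewrite rnormZ normc_real. Qed.

Lemma rnorm_small_eq0 x : (forall e, 0 < e -> rnorm x <= e) -> x = 0.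
Proof.
move=> h; apply: rnorm_eq0; apply/eqP; rewrite eq_le rnorm_ge0 andbT.
by apply/ler_addgt0Pr => e e0; rewrite add0r h.
Qed.

End RealNorm.

Lemma geo_lt (R : realType) (K e : R) : 0 < e ->
  exists n : nat, forall m, (n <= m)%N -> K * 2^-1 ^+ m < e.
Proof.
move=> e0; have [K0|K0] := leP K 0.
  exists 0%N => m _; apply: le_lt_trans e0.
  by rewrite mulr_le0_ge0 // exprn_ge0 // invr_ge0.
pose t := Num.trunc (K / e); exists t.+1 => m tm.
have h : K / e < m%:R.
  apply: (lt_le_trans (truncnS_gt _)); rewrite ler_nat //.
have h2 : m%:R < 2 ^+ m :> R by rewrite -natrX ltr_nat ltn_expl.
rewrite exprVn ltr_pdivrMr ?exprn_gt0 // mulrC -ltr_pdivrMr //.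
exact: lt_trans h2.
Qed.

Section Completeness.
Variables (R : realType) (V : completeNormedModType R[i]).

(** All later uses of completeness go through this form, with an explicit rate so that limits can be
    handled by estimates. *)
Lemma geo_cvg (K : R) (u : nat -> V) :
  (forall n, rnorm (u n.+1 - u n) <= K * 2^-1 ^+ n) ->
  exists l, forall n, rnorm (l - u n) <= 2 * K * 2^-1 ^+ n.
Proof.
move=> hu.
(* The factor 1 - 2^-k strengthens the bound just enough for the induction on k. *)
have hd n k : rnorm (u (n + k)%N - u n) <= 2 * K * 2^-1 ^+ n * (1 - 2^-1 ^+ k).
  elim: k => [|k IH]; first by rewrite addn0 subrr rnorm0 expr0 subrr mulr0.
  have := ler_rdist (u (n + k.+1)%N) (u (n + k)%N) (u n).
  have := hu (n + k)%N; rewrite addnS exprD exprS.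
  set a := 2^-1 ^+ n in IH *; set b := 2^-1 ^+ k in IH *. lra.
have K0 : 0 <= K by have := hu 0%N; rewrite expr0 mulr1; apply: le_trans; exact: rnorm_ge0.
have hd' n m : (n <= m)%N -> rnorm (u m - u n) <= 2 * K * 2^-1 ^+ n.
  move=> nm; have := hd n (m - n)%N; rewrite subnKC //.
  have h1 : 0 <= (2^-1 : R) ^+ n by rewrite exprn_ge0 // invr_ge0.
  have h2 : 0 <= (2^-1 : R) ^+ (m - n) by rewrite exprn_ge0 // invr_ge0.
  move/le_trans; apply; rewrite ler_piMr ?mulr_ge0 // lerBlDr lerDl.
have cu : cvg (u @ \oo).
  apply: cauchy_cvg; apply: cauchy_exP => e e0.
  have e'0 : 0 < complex.Re e by move: e0; rewrite ltcE => /andP[].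
  have [n hn] := geo_lt (2 * K) e'0.
  exists (u n), n => // m /= nm; rewrite -ball_normE /=.
  rewrite rnormE rnormB -[e]RRe_real ?gtr0_real // ltcR.
  exact: le_lt_trans (hd' n m nm) (hn n (leqnn n)).
exists (lim (u @ \oo)) => n; apply/ler_addgt0Pr => e e0.
have : \forall m \near \oo, ball (lim (u @ \oo)) e%:C%C (u m).
  by apply: cu; apply: nbhsx_ballx; rewrite ltcR.
case=> N _ hN; have := hN (maxn N n) (leq_maxl _ _).
rewrite /= -ball_normE /= rnormE ltcR => h.
have := hd' _ _ (leq_maxr N n); have := ler_rdist (lim (u @ \oo)) (u (maxn N n)) (u n).
by lra.
Qed.

End Completeness.

(** * Vanishing spectral radius *)

Lemma expr_small (R : realType) (q e : R) : 0 <= q -> q < 1 -> 0 < e ->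
  exists M : nat, forall m, (M <= m)%N -> q ^+ m < e.
Proof.
move=> q0 q1 e0; have /cvgrPdist_lt/(_ e e0)[M _ hM] : q ^+ n @[n --> \oo] --> 0.
  by apply: cvg_expr; rewrite ger0_norm.
exists M => m /hM; rewrite sub0r normrN ger0_norm //; exact: exprn_ge0.
Qed.

Section ComplexModulus.
Variable R : realType.
Implicit Types (z : R[i]) (x y : R).

Lemma normc_ge0 z : 0 <= Normc.normc z.
Proof. by case: z => x y; exact: sqrtr_ge0. Qed.

Lemma normc_ge_ReIm x y :
  `|x| <= Normc.normc (x +i* y)%C /\ `|y| <= Normc.normc (x +i* y)%C.
Proof. by rewrite /= -!sqrtr_sqr !ler_sqrt ?addr_ge0 ?sqr_ge0 // lerDl lerDr !sqr_ge0. Qed.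

Lemma normc_le_ReIm x y : Normc.normc (x +i* y)%C <= `|x| + `|y|.
Proof.
rewrite -[leRHS]ger0_norm ?addr_ge0 // -sqrtr_sqr /= ler_sqrt ?sqr_ge0 //.
rewrite sqrrD !real_normK ?num_real // addrAC lerDl mulrn_wge0 //; exact: mulr_ge0.
Qed.

(** The disc lies in a compact square; in the covering form of compactness the bound M is the
    parameter tending to infinity. *)
Lemma bounded_on_disc (f : R[i] -> R) (r : R) :
  (forall z, exists d M, 0 < d /\ forall w, Normc.normc (w - z) < d -> f w <= M) ->
  exists M, forall z, Normc.normc z <= r -> f z <= M.
Proof.
move=> locb; have cr : compact (`[- r, r] `*` `[- r, r]).
  by apply: compact_setX; exact: segment_compact.
move/compact_near_coveringP : cr.
move=> /(_ R (pinfty_nbhs R) (fun M p => f (p.1 +i* p.2)%C <= M)).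
case=> [[x y] _|M [_ hM]]; last first.
  exists (M + 1) => -[x y] xyr; have := hM (M + 1); rewrite ltrDl ltr01.
  move=> /(_ isT (x, y)) /=; apply; split; rewrite /= in_itv /= -ler_norml.
  - by apply: le_trans xyr; have [] := normc_ge_ReIm x y.
  - by apply: le_trans xyr; have [] := normc_ge_ReIm x y.
have [d [M [d0 hM]]] := locb (x +i* y)%C.
have d20 : 0 < d / 2 by lra.
exists (ball (x, y) (d / 2), [set M' | M <= M']).
  split; first exact: nbhsx_ballx.
  by exists M; split; [exact: num_real|move=> M' /ltW].
move=> [[x' y'] M'] /= [[bx by_] MM']; apply: le_trans MM'; apply: hM.
move: bx by_; rewrite /ball /= => bx by_.
apply: le_lt_trans (normc_le_ReIm (x' - x) (y' - y)) _.
rewrite (distrC x') (distrC y'); lra.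
Qed.

End ComplexModulus.

Section SpectralRadius.
Variables (R : realType) (K : comNzRingType) (iota : {rmorphism R[i] -> K}).
Variable N : K -> R.
Hypothesis N_ge0 : forall x, 0 <= N x.
Hypothesis ler_ND : forall x y, N (x + y) <= N x + N y.
Hypothesis ler_NM : forall x y, N (x * y) <= N x * N y.
Hypothesis N_scale : forall l x, N (iota l * x) = Normc.normc l * N x.

Let NN x : N (- x) = N x.
Proof.
have -> : - x = iota (-1) * x by ring.
by rewrite N_scale normcN Normc.normc1 mul1r.
Qed.

Let inv_uniq (a b c : K) : a * c = 1 -> b * c = 1 -> a = b.
Proof. by move=> ac bc; rewrite -[a]mulr1 -bc mulrCA ac mulr1. Qed.

Variable g : K.
Hypothesis invertible : forall l, exists h, h * (1 - iota l * g) = 1.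

(** With s^2 = l and G the previous power of g, 1 - l G^2 factors as (1 - s G)(1 + s G). *)
Let resolvent_exists m l : exists h, h * (1 - iota l * g ^+ (2 ^ m)) = 1.
Proof.
elim: m l => [|m IH] l; first by rewrite expn0 expr1; exact: invertible.
have [a ha] := IH (sqrtc l); have [b hb] := IH (- sqrtc l).
exists (a * b); rewrite -{1}[l]sqr_sqrtc expnSr exprM.
move: ha hb; set s := sqrtc l; set G := g ^+ _ => ha hb.
have -> : 1 - iota (s ^+ 2) * G ^+ 2 = (1 - iota s * G) * (1 - iota (- s) * G) by ring.
by rewrite mulrACA ha hb mulr1.
Qed.

Let H m l : K := projT1 (cid (resolvent_exists m l)).

Let HE m l : H m l * (1 - iota l * g ^+ (2 ^ m)) = 1.
Proof. exact: projT2 (cid (resolvent_exists m l)). Qed.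

Let H_avg m s : H m.+1 (s ^+ 2) = iota 2^-1 * (H m s + H m (- s)).
Proof.
apply: inv_uniq (HE m.+1 (s ^+ 2)) _; have := HE m s; have := HE m (- s).
rewrite expnSr exprM; set a := H m s; set b := H m (- s); set G := g ^+ _ => hb ha.
have -> : iota 2^-1 * (a + b) * (1 - iota (s ^+ 2) * G ^+ 2) =
   iota 2^-1 * ((a * (1 - iota s * G)) * (1 - iota (- s) * G) +
                (b * (1 - iota (- s) * G)) * (1 - iota s * G)) by ring.
rewrite ha hb !mul1r; have -> : 1 - iota (- s) * G + (1 - iota s * G) = iota 2 by ring.
by rewrite -rmorphM mulVf ?rmorph1 // pnatr_eq0.
Qed.

(** The resolvent identity gives local bounds, and compactness of the disc makes them uniform. *)
Let H_bounded r : exists B, 0 <= B /\ forall l, Normc.normc l <= r -> N (H 0 l) <= B.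
Proof.
have [z|B hB] := @bounded_on_disc R (fun l => N (H 0 l)) r; last first.
  exists `|B|; split=> // l /hB /le_trans; apply; exact: ler_norm.
pose c := N g * N (H 0 z); have c0 : 0 <= c by exact: mulr_ge0.
(* Within this radius |w - z| c is at most 1/2, so N b <= N a + N b / 2. *)
exists (1 / (2 * (c + 1))), (2 * N (H 0 z)); split.
  by rewrite divr_gt0 // mulr_gt0 // ltr_wpDl.
move=> w; rewrite ltr_pdivlMr ?mulr_gt0 ?ltr_wpDl // => wz.
have := HE 0 w; have := HE 0 z; rewrite expn0 expr1.
set a := H 0 z; set b := H 0 w => ha hb.
have eb : b = a + iota (w - z) * (g * a * b).
  have -> : a + iota (w - z) * (g * a * b) =
    a * (b * (1 - iota w * g)) + iota (w - z) * (g * a * b) by rewrite hb mulr1.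
  by rewrite -[LHS]mul1r -{1}ha; ring.
have h1 : N b <= N a + Normc.normc (w - z) * (c * N b).
  rewrite {1}eb; apply: le_trans (ler_ND _ _) _; rewrite lerD2l N_scale.
  rewrite ler_wpM2l ?normc_ge0 //; apply: le_trans (ler_NM _ _) _.
  by rewrite ler_wpM2r.
have h2 := normc_ge0 (w - z); have h3 := N_ge0 b.
have : Normc.normc (w - z) * c * N b <= 1 / 2 * N b.
  by apply: ler_wpM2r => //; lra.
by lra.
Qed.

Let circle_close m (t u e : R) := forall v, Normc.normc v = 1 ->
  N (H m ((t ^+ (2 ^ m))%:C%C * v) - H m ((u ^+ (2 ^ m))%:C%C * v)) <= e.

(* By H_avg, H (m+1) is an average of values of H m, so closeness on two circles
   passes from 1 - l g to all 1 - l g^(2^m): this replaces Liouville's theorem. *)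
Let circle_closeS t u e : circle_close 0 t u e -> forall m, circle_close m t u e.
Proof.
move=> h0; elim=> [//|m IH] v v1.
have s1 : Normc.normc (sqrtc v) = 1.
  apply/eqP; rewrite -sqrp_eq1 ?normc_ge0 // expr2 -Normc.normcM -expr2 sqr_sqrtc v1 //.
have E (r : R) : (r ^+ (2 ^ m.+1))%:C%C * v = ((r ^+ (2 ^ m))%:C%C * sqrtc v) ^+ 2.
  by rewrite exprMn sqr_sqrtc expnSr exprM rmorphXn.
rewrite !E !H_avg -mulrBr N_scale.
rewrite opprD addrACA.
have -> : Normc.normc (2^-1 : R[i]) = 2^-1.
  by rewrite Normc.normcV (normcMn 1 2) Normc.normc1.
have h := IH _ s1; have : Normc.normc (- sqrtc v) = 1 by rewrite normcN.
move=> /IH; rewrite !mulrN => h'.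
by have := le_trans (ler_ND _ _) (lerD h h'); lra.
Qed.

(** By the resolvent identity and [H_bounded], [H 0] is Lipschitz on the disc of radius T; [c]
    bounds N (g b a) there. *)
Let circle_uniform (T e : R) : 0 < e -> exists d, [/\ 0 < d, d <= 1 &
  forall t u, 0 <= t -> t <= T -> 0 <= u -> u <= T -> `|t - u| <= d ->
    circle_close 0 t u e].
Proof.
move=> e0; have [B [B0 hB]] := H_bounded T.
pose c := N g * B * B; have c0 : 0 <= c by rewrite !mulr_ge0.
have ec0 : 0 < e / (c + 1) by rewrite divr_gt0 // ltr_wpDl.
exists (Num.min 1 (e / (c + 1))); split; first by rewrite lt_min ltr01.
  by rewrite ge_min lexx.
move=> t u t0 tT u0 uT; rewrite le_min => /andP[_]; rewrite ler_pdivlMr ?ltr_wpDl //.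
move=> tu v v1; rewrite expn0 !expr1.
have nv (r : R) : 0 <= r -> r <= T -> Normc.normc (r%:C%C * v) <= T.
  by move=> r0 rT; rewrite Normc.normcM v1 mulr1 /= expr0n addr0 sqrtr_sqr ger0_norm.
have := hB _ (nv t t0 tT); have := hB _ (nv u u0 uT).
have := HE 0 (t%:C%C * v); have := HE 0 (u%:C%C * v); rewrite expn0 expr1.
set a := H 0 _; set b := H 0 (t%:C%C * v) => ha hb Na Nb.
have -> : b - a = iota ((t - u)%:C%C * v) * (g * b * a).
  have -> : b - a = b * (a * (1 - iota (u%:C%C * v) * g)) -
                    a * (b * (1 - iota (t%:C%C * v) * g)) by rewrite ha hb !mulr1.
  by rewrite rmorphB; ring.
have -> : N (iota ((t - u)%:C%C * v) * (g * b * a)) = `|t - u| * N (g * b * a).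
  by rewrite N_scale Normc.normcM v1 mulr1 /= expr0n addr0 sqrtr_sqr.
have h1 : N (g * b * a) <= c.
  apply: le_trans (ler_NM _ _) _; apply: ler_pM => //.
  by apply: le_trans (ler_NM _ _) _; rewrite ler_wpM2l.
have := normr_ge0 (t - u); nra.
Qed.

Let vanish (t : R) := forall e, 0 < e -> exists M, forall m, (M <= m)%N ->
  t ^+ (2 ^ m) * N (g ^+ (2 ^ m)) < e.

(** Since t^(2^m) g^(2^m) tends to 0, its resolvent gets close to 1, so the resolvent at radius u is
    eventually within 1/4 of 1. This bounds u^(2^m) g^(2^m), and the factor (w/u)^(2^m) tends to
    0. *)
Let vanish_step (t u w : R) : 0 <= t -> 0 <= w -> w < u -> vanish t ->
  circle_close 0 u t (1 / 8) -> vanish w.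
Proof.
move=> t0 w0 wu vt /circle_closeS ct e e0; have u0 : 0 < u by exact: le_lt_trans wu.
pose n1 := N 1; have n10 : 0 <= n1 by exact: N_ge0.
have d0 : 0 < 1 / (16 * (n1 + 1)) by rewrite divr_gt0 // mulr_gt0 // ltr_wpDl.
have [M hM] := vt _ d0.
have [|||M' hM'] := @expr_small R (w / u) e => //.
- by rewrite divr_ge0 // ltW.
- by rewrite ltr_pdivrMr // mul1r.
exists (maxn M M') => m; rewrite geq_max => /andP[/hM hm /hM' hm'].
have := ct m 1 (Normc.normc1 _); rewrite !mulr1.
have := HE m (u ^+ (2 ^ m))%:C%C; have := HE m (t ^+ (2 ^ m))%:C%C.
have normE (r : R) : 0 <= r -> N (iota (r ^+ (2 ^ m))%:C%C * g ^+ (2 ^ m)) =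
    r ^+ (2 ^ m) * N (g ^+ (2 ^ m)).
  by move=> r0; rewrite N_scale /= expr0n addr0 sqrtr_sqr ger0_norm // exprn_ge0.
move: (normE _ t0) (normE _ (ltW u0)).
set X := H m _; set X' := H m (u ^+ (2 ^ m))%:C%C.
set y := iota _ * _; set y' := iota (u ^+ _)%:C%C * _ => ny ny' hX hX' XX'.
have h1 : N (X - 1) <= (n1 + N (X - 1)) * N y.
  have -> : X - 1 = X * y by rewrite -[1 in LHS]hX; ring.
  apply: le_trans (ler_NM _ _) _; rewrite ler_wpM2r //.
  have -> : X * y = X - 1 by rewrite -[1 in RHS]hX; ring.
  by rewrite -{1}[X](subrK 1) addrC ler_ND.
have h2 : N y * (16 * (n1 + 1)) < 1.
  by rewrite -ltr_pdivlMr ?mulr_gt0 ?ltr_wpDl // ny.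
have h3 : N (X - 1) <= 1 / 8 by have := N_ge0 y; have := N_ge0 (X - 1); nra.
have h4 : N (X' - 1) <= 1 / 4.
  have := ler_ND (X' - X) (X - 1); rewrite addrA subrK; lra.
have h5 : N y' <= 1 / 4 + 1 / 4 * N y'.
  (* This rearranges X' (1 - y') = 1 and lets y' be absorbed, as N (X' - 1) <= 1/4. *)
  have e1 : y' = (X' - 1) - (X' - 1) * y'.
    by rewrite -[LHS]add0r -(subrr 1) -{1}hX'; ring.
  rewrite {1}e1; apply: le_trans (ler_ND _ _) _; rewrite NN; apply: lerD => //.
  by apply: le_trans (ler_NM _ _) _; rewrite ler_wpM2r.
have h6 : u ^+ (2 ^ m) * N (g ^+ (2 ^ m)) <= 1 by rewrite -ny'; lra.
have -> : w = (w / u) * u by rewrite divfK // gt_eqF.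
rewrite exprMn -mulrA; apply: le_lt_trans hm'.
have q0 : 0 <= w / u by rewrite divr_ge0 // ltW.
have q1 : w / u <= 1 by rewrite ler_pdivrMr // mul1r ltW.
apply: (@le_trans _ _ ((w / u) ^+ (2 ^ m))); first by rewrite ler_piMr // exprn_ge0.
by apply: ler_wiXn2l => //; apply: ltnW; exact: ltn_expl.
Qed.

(** Starting from radius 0, where vanishing is trivial, [vanish_step] advances by d/2 at a time, d
    being the uniform modulus of continuity. *)
Lemma spectral_radius_eq0 (r : R) : 0 <= r -> forall e, 0 < e ->
  exists M, forall m, (M <= m)%N -> r ^+ (2 ^ m) * N (g ^+ (2 ^ m)) < e.
Proof.
(* A step compares radii t1 and t1 + d with t1 <= r and d <= 1, hence the disc of radius r + 1. *)
move=> r0; rewrite -/(vanish r); have [d [d0 d1 hd]] := @circle_uniform (r + 1) (1 / 8) ltac:(lra).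
have : forall k t, 0 <= t -> t <= r -> t <= k%:R * (d / 2) -> vanish t.
  elim=> [|k IH] t t0 tr tk.
    have -> : t = 0 by apply/eqP; rewrite eq_le t0 andbT; move: tk; rewrite mul0r.
    by move=> e e0; exists 0%N => m _; rewrite expr0n expn_eq0 /= mul0r.
  pose t1 := Num.max 0 (t - d / 2).
  have t10 : 0 <= t1 by rewrite le_max lexx.
  have t1t : t1 <= t by rewrite ge_max t0 /=; lra.
  have t1d : t <= t1 + d / 2 by rewrite -lerBlDr le_max lexx orbT.
  have t1k : t1 <= k%:R * (d / 2).
    rewrite ge_max mulr_ge0 //=; last by lra.
    by move: tk; rewrite -natr1; lra.
  apply: (@vanish_step t1 (t1 + d)) => //.
  - lra.
  - by apply: IH => //; lra.
  - by apply: hd => //; try lra; rewrite addrAC subrr add0r ger0_norm // ltW.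
move=> /(_ (Num.trunc (r / (d / 2))).+1 r r0 (lexx r)); apply.
by rewrite -ler_pdivrMr ?ltW ?truncnS_gt //; lra.
Qed.

End SpectralRadius.

(** * Separating spaces *)

Section ClosedGraph.
Variables (R : realType) (V : completeNormedModType R[i]).

(** Otherwise one builds nested balls, the n-th choice avoiding W n, whose centres converge to a
    point in no W n. *)
Lemma baire_somewhere_dense (W : nat -> set V) : (forall x, exists n, W n x) ->
  exists n x r, 0 < r /\ forall y, rnorm (y - x) < r ->
    forall e, 0 < e -> exists z, W n z /\ rnorm (y - z) < e.
Proof.
move=> Wcover; apply: contrapT => nowhere.
have /choice[f fP] : forall a : nat * (V * R), exists b : V * R, 0 < a.2.2 ->
    [/\ 0 < b.2, b.2 <= a.2.2 / 2, rnorm (b.1 - a.2.1) <= a.2.2 / 2 &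
        forall z, W a.1 z -> b.2 < rnorm (b.1 - z)].
  move=> [n [x r]] /=; have [r0|] := ltP 0 r; last by exists (x, r).
  suff [y [yx [e [e0 ye]]]] : exists y, rnorm (y - x) < r / 2 /\
      exists e, 0 < e /\ forall z, W n z -> e <= rnorm (y - z).
    exists (y, Num.min (r / 2) (e / 2)); split=> /= [||| z /ye].
    - by rewrite lt_min; apply/andP; split; lra.
    - by rewrite ge_min lexx.
    - exact: ltW.
    - by rewrite gt_min => ?; apply/orP; right; lra.
  apply: contrapT => no; apply: nowhere; exists n, x, (r / 2); split; first lra.
  move=> y yx e e0; apply: contrapT => noz; apply: no; exists y; split=> //.
  exists e; split=> // z Wz; rewrite leNgt; apply/negP => ze.
  by apply: noz; exists z.
pose s n := iteri n (fun k a => f (k, a)) (0 : V, 1 : R).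
have s0 n : 0 < (s n).2.
  by elim: n => [|n IH] /=; [exact: ltr01|have [] := fP (n, s n) IH].
have sS n := fP (n, s n) (s0 n).
have sgeo n : (s n).2 <= 2^-1 ^+ n.
  elim: n => [|n IH] //; have [_ + _ _] := sS n; rewrite exprS /= => /le_trans; apply.
  by lra.
have [|l hl] := @geo_cvg R V 1 (fun n => (s n).1).
  move=> n; have [_ _ + _] := sS n; move=> /le_trans; apply.
  have /= := s0 n; have /= := sgeo n; lra.
(* Nestedness of the balls: the centre moves by no more than the radius drops. *)
have dist n k : rnorm ((s (n + k)%N).1 - (s n).1) <= (s n).2 - (s (n + k)%N).2.
  elim: k => [|k IH]; first by rewrite addn0 !subrr rnorm0.
  have [_ /= h1 h2 _] := sS (n + k)%N; rewrite addnS /=.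
  apply: le_trans (ler_rdist _ (s (n + k)%N).1 _) _; lra.
have lim n : rnorm (l - (s n).1) <= (s n).2.
  apply/ler_addgt0Pr => e e0; have [N hN] := geo_lt (2 * 1) e0.
  have := hl (n + N)%N; have := hN (n + N)%N (leq_addl _ _); have := dist n N.
  have := s0 (n + N)%N; have := ler_rdist l (s (n + N)%N).1 (s n).1; lra.
have [n Wn] := Wcover l; have [_ _ _ /(_ _ Wn)] := sS n.
by have := lim n.+1; rewrite rnormB /=; lra.
Qed.

Definition separating (T : V -> V) : set V :=
  [set s | forall e, 0 < e -> exists x, rnorm x < e /\ rnorm (T x - s) < e].

Section Separating.
Variable T : V -> V.
Hypothesis linT : forall (l : R[i]) a b, T (l *: a + b) = l *: T a + T b.

Let T0 : T 0 = 0.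
Proof. by have := linT 1 0 0; rewrite !scale1r addr0 -[LHS]addr0 => /addrI. Qed.

Let TZ l a : T (l *: a) = l *: T a.
Proof. by have := linT l a 0; rewrite T0 !addr0. Qed.

Let TD a b : T (a + b) = T a + T b.
Proof. by have := linT 1 a b; rewrite !scale1r. Qed.

Let TB a b : T (a - b) = T a - T b.
Proof. by rewrite TD -scaleN1r TZ scaleN1r. Qed.

Lemma separating0 : separating T 0.
Proof. by move=> e e0; exists 0; rewrite T0 subrr rnorm0. Qed.

Lemma separatingD s t : separating T s -> separating T t -> separating T (s + t).
Proof.
move=> hs ht e e0; have e20 : 0 < e / 2 by lra.
have [x [x1 x2]] := hs _ e20; have [y [y1 y2]] := ht _ e20.
exists (x + y); split; first by have := ler_rnormD x y; lra.
by rewrite TD opprD addrACA; have := ler_rnormD (T x - s) (T y - t); lra.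
Qed.

Lemma separatingZ l s : separating T s -> separating T (l *: s).
Proof.
move=> hs e e0; have nl0 := normc_ge0 l.
have d0 : 0 < e / (Normc.normc l + 1) by rewrite divr_gt0 // ltr_wpDl.
have [x [x1 x2]] := hs _ d0.
have small (z : V) : rnorm z < e / (Normc.normc l + 1) -> rnorm (l *: z) < e.
  rewrite ltr_pdivlMr ?ltr_wpDl // rnormZ; have := rnorm_ge0 z; nra.
by exists (l *: x); rewrite TZ -scalerBr; split; exact: small.
Qed.

Lemma separatingN s : separating T s -> separating T (- s).
Proof. by rewrite -scaleN1r; exact: separatingZ. Qed.

Lemma separatingB s t : separating T s -> separating T t -> separating T (s - t).
Proof. by move=> hs ht; apply: separatingD => //; exact: separatingN. Qed.

(** Baire's theorem applies to the sets of x with T x within n of the separating space. Differences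
    of approximants move the ball to the origin, and homogeneity extends the bound to all x. *)
Lemma separating_almost_bounded : exists K, 0 <= K /\ forall x e, 0 < e ->
  exists z s, [/\ separating T s, rnorm (x - z) < e & rnorm (T z - s) <= K * rnorm x].
Proof.
pose W n := [set x | exists s, separating T s /\ rnorm (T x - s) <= n%:R].
have [|n [x0 [r [r0 dense]]]] := @baire_somewhere_dense W.
  move=> x; exists (Num.trunc (rnorm (T x))).+1, 0; split; first exact: separating0.
  by rewrite subr0 ltW // truncnS_gt.
(* Scaling x to norm r/2 turns the bound 2 n of [base] into this constant. *)
exists (4 * n%:R / r); split; first by rewrite !mulr_ge0 // invr_ge0 ltW.
have base x e : rnorm x < r -> 0 < e -> exists z s,
    [/\ separating T s, rnorm (x - z) < e & rnorm (T z - s) <= 2 * n%:R].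
  move=> xr e0; have e20 : 0 < e / 2 by lra.
  have [|z1 [[s1 [hs1 n1]] d1]] := dense (x0 + x) _ _ e20.
    by rewrite addrAC subrr add0r.
  have [|z2 [[s2 [hs2 n2]] d2]] := dense x0 _ _ e20; first by rewrite subrr rnorm0.
  exists (z1 - z2), (s1 - s2); split; first exact: separatingB.
    have -> : x - (z1 - z2) = (x0 + x - z1) - (x0 - z2) by abel.
    by have := ler_rnormB (x0 + x - z1) (x0 - z2); lra.
  have -> : T (z1 - z2) - (s1 - s2) = (T z1 - s1) - (T z2 - s2) by rewrite TB; abel.
  by have := ler_rnormB (T z1 - s1) (T z2 - s2); lra.
move=> x e e0; have [x_gt0|] := ltP 0 (rnorm x); last first.
  move=> x_le0; have -> : x = 0.
    by apply: rnorm_eq0; apply/eqP; rewrite eq_le x_le0 rnorm_ge0.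
  exists 0, 0; rewrite T0 !subrr rnorm0 mulr0; split=> //; exact: separating0.
pose c := r / (2 * rnorm x).
have c0 : 0 < c by rewrite divr_gt0 // mulr_gt0.
have [||z [s [hs d1 d2]]] := base (c%:C%C *: x) (c * e).
- rewrite (rnormZr _ (ltW c0)) /c invfM !mulrA divfK ?gt_eqF //; lra.
- exact: mulr_gt0.
have cK (u : V) : u = c%:C%C *: (c^-1%:C%C *: u).
  by rewrite scalerA -rmorphM /= divff ?gt_eqF // scale1r.
exists (c^-1%:C%C *: z), (c^-1%:C%C *: s); split; first exact: separatingZ.
  by move: d1; rewrite {1}[z]cK -scalerBr (rnormZr _ (ltW c0)) ltr_pM2l.
have ci0 : 0 <= c^-1 by rewrite invr_ge0 ltW.
rewrite TZ -scalerBr rnormZr //.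
rewrite -(ler_pM2l c0) mulrA divff ?gt_eqF // mul1r.
apply: le_trans d2 _; rewrite le_eqVlt; apply/orP; left; apply/eqP.
by rewrite /c; field; rewrite !gt_eqF.
Qed.

(** This is the closed graph theorem for T followed by the quotient by its separating space, stated
    without forming the quotient. The approximations of the previous lemma are iterated on the
    remainders. *)
Lemma closed_graph_mod_separating : exists C, 0 <= C /\ forall x,
  exists s, separating T s /\ rnorm (T x - s) <= C * rnorm x.
Proof.
have [K [K0 hK]] := separating_almost_bounded.
exists (2 * K); split=> [|x]; first by rewrite mulr_ge0.
have [x_gt0|] := ltP 0 (rnorm x); last first.
  move=> x_le0; have -> : x = 0.
    by apply: rnorm_eq0; apply/eqP; rewrite eq_le x_le0 rnorm_ge0.
  by exists 0; rewrite T0 !subrr rnorm0 mulr0; split=> //; exact: separating0.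
have /choice[f fP] : forall a : nat * V, exists b : V * V,
    [/\ separating T b.2, rnorm (a.2 - b.1) < rnorm x * 2^-1 ^+ a.1.+1 &
        rnorm (T b.1 - b.2) <= K * rnorm a.2].
  move=> [n y] /=; have e0 : 0 < rnorm x * 2^-1 ^+ n.+1.
    by rewrite mulr_gt0 // exprn_gt0 // invr_gt0.
  by have [z [s ?]] := hK y _ e0; exists (z, s).
(* [X n] is the remainder, [sg n] the accumulated separating part and [Y n] the bounded part, which
   converges to some y. *)
pose X n := iteri n (fun k y => y - (f (k, y)).1) x.
pose sg n := \sum_(k < n) (f (val k, X k)).2.
pose Y n := \sum_(k < n) (T (f (val k, X k)).1 - (f (val k, X k)).2).
have hX n : rnorm (X n) <= rnorm x * 2^-1 ^+ n.
  case: n => [|n]; first by rewrite expr0 mulr1.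
  by have [_ /ltW] := fP (n, X n).
have hY n : rnorm (Y n.+1 - Y n) <= K * rnorm x * 2^-1 ^+ n.
  rewrite /Y big_ord_recr /= addrAC subrr add0r.
  have [_ _ /le_trans] := fP (n, X n); apply; rewrite -mulrA ler_wpM2l //; exact: hX.
have hsg : forall m, separating T (sg m).
  elim=> [|n IH]; first by rewrite /sg big_ord0; exact: separating0.
  by rewrite /sg big_ord_recr /=; apply: separatingD => //; have [] := fP (n, X n).
have split n : T x = T (X n) + Y n + sg n.
  elim: n => [|n IH]; first by rewrite /Y /sg !big_ord0 !addr0.
  rewrite {1}IH /Y /sg !big_ord_recr /= -/(Y n) -/(sg n) TB.
  by abel.
have [y hy] := geo_cvg hY.
exists (T x - y); split; last first.
  by rewrite subKr; have := hy 0%N; rewrite /Y big_ord0 subr0 expr0 mulr1 mulrA.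
move=> e e0; have e20 : 0 < e / 2 by lra.
have [N hN] := geo_lt (2 * (K * rnorm x)) e20.
have [M hM] := geo_lt (rnorm x) e20.
have [x' [x'1 x'2]] := hsg (maxn N M) _ e20; set n := maxn N M in x'2.
(* Here x' is small with T x' near [sg n]; it cancels the term [- sg n] in T (X n) = T x - Y n - sg
   n. *)
exists (X n + x'); split.
  by have := ler_rnormD (X n) x'; have := hX n; have := hM n (leq_maxr _ _); lra.
have -> : T (X n + x') - (T x - y) = (T x' - sg n) + (y - Y n).
  by rewrite TD (split n); abel.
have := ler_rnormD (T x' - sg n) (y - Y n).
by have := hy n; have := hN n (leq_maxl _ _); lra.
Qed.

End Separating.
End ClosedGraph.

(** * Derivations of Banach algebras *)

Section BanachAlgebra.
Variables (R : realType) (V : completeNormedModType R[i]) (mul : V -> V -> V).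
Hypothesis ban : banach_algebra_mul mul.

Local Notation "x ** y" := (mul x y) (at level 40, left associativity).

Lemma bmulA a b c : a ** b ** c = a ** (b ** c). Proof. by case: ban. Qed.
Lemma bmulDl a b c : (a + b) ** c = a ** c + b ** c. Proof. by case: ban. Qed.
Lemma bmulDr a b c : a ** (b + c) = a ** b + a ** c. Proof. by case: ban. Qed.
Lemma bmulZl (l : R[i]) a b : (l *: a) ** b = l *: (a ** b).
Proof. by case: ban => _ _ _ /(_ l a b)[]. Qed.
Lemma bmulZr (l : R[i]) a b : a ** (l *: b) = l *: (a ** b).
Proof. by case: ban => _ _ _ /(_ l a b)[]. Qed.
Lemma bmul0l a : 0 ** a = 0. Proof. by have := bmulZl 0 0 a; rewrite !scale0r. Qed.
Lemma bmul0r a : a ** 0 = 0. Proof. by have := bmulZr 0 a 0; rewrite !scale0r. Qed.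
Lemma bmulNl a b : (- a) ** b = - (a ** b).
Proof. by rewrite -scaleN1r bmulZl scaleN1r. Qed.
Lemma bmulNr a b : a ** (- b) = - (a ** b).
Proof. by rewrite -scaleN1r bmulZr scaleN1r. Qed.
Definition bmulE := (bmulDl, bmulDr, bmulNl, bmulNr, bmulZl, bmulZr, bmul0l, bmul0r).

Lemma ler_rnormM a b : rnorm (a ** b) <= rnorm a * rnorm b.
Proof. by rewrite -lecR rmorphM /= -!rnormE; case: ban. Qed.

(** * Neumann series and quasi-inverses *)

Lemma geo_eq0 (x : V) K : (forall n, rnorm x <= K * 2^-1 ^+ n) -> x = 0.
Proof.
move=> h; apply: rnorm_small_eq0 => e e0; have [n /(_ n (leqnn n)) hn] := geo_lt K e0.
exact: le_trans (h n) (ltW hn).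
Qed.

(** The hypothesis bounds the powers z^(n+1) themselves, so that quasi-nilpotent elements of any
    norm are covered. *)
Lemma neumann z M : (forall n, rnorm (iter n (mul^~ z) z) <= M * 2^-1 ^+ n) ->
  quasi_invertible mul z.
Proof.
move=> hM; pose u n := iter n (fun y => z + y ** z) 0.
have du n : u n.+1 - u n = iter n (mul^~ z) z.
  elim: n => [|n IH]; first by rewrite /u /= bmul0l subr0 addr0.
  by rewrite [RHS]/= -IH bmulDl bmulNl /u /=; abel.
have cu n : u n ** z = z ** u n.
  elim: n => [|n IH]; first by rewrite /u /= bmul0l bmul0r.
  by rewrite /u /= -/(u n) bmulDl bmulDr IH bmulA IH.
have [|l hl] := @geo_cvg R V M u; first by move=> n; rewrite du.
have lE : l - (z + l ** z) = 0.
  apply: (@geo_eq0 _ (2 * M + 2 * M * rnorm z)) => n.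
  have -> : l - (z + l ** z) = (l - u n.+1) - (l - u n) ** z.
    by rewrite [u n.+1]/u /= -/(u n) bmulDl bmulNl; abel.
  have h1 := ler_rnormB (l - u n.+1) ((l - u n) ** z).
  have h2 := ler_rnormM (l - u n) z; have h3 := hl n; have h4 := hl n.+1.
  have h5 := rnorm_ge0 z; have h6 := rnorm_ge0 (l - u n.+1).
  have h7 : rnorm (l - u n) * rnorm z <= 2 * M * 2^-1 ^+ n * rnorm z.
    by apply: ler_wpM2r.
  by move: h4 h6; rewrite exprS; lra.
have lC : l ** z - z ** l = 0.
  apply: (@geo_eq0 _ (2 * (2 * M * rnorm z))) => n.
  have -> : l ** z - z ** l = (l - u n) ** z - z ** (l - u n).
    by rewrite bmulDl bmulDr bmulNl bmulNr cu; abel.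
  have h1 := ler_rnormB ((l - u n) ** z) (z ** (l - u n)).
  have h2 := ler_rnormM (l - u n) z; have h3 := ler_rnormM z (l - u n).
  have h5 := rnorm_ge0 z; have h6 := hl n.
  have h7 : rnorm (l - u n) * rnorm z <= 2 * M * 2^-1 ^+ n * rnorm z.
    by apply: ler_wpM2r.
  by lra.
(* In the unitization 1 + l inverts 1 - z, so the quasi-inverse is -l. *)
exists (- l); rewrite bmulNr bmulNl; split.
  have -> : z - l - - (z ** l) = - (l - (z + l ** z)) - (l ** z - z ** l) by abel.
  by rewrite lE lC oppr0 addr0.
have -> : z - l - - (l ** z) = - (l - (z + l ** z)) by abel.
by rewrite lE oppr0.
Qed.

Lemma neumann_half z : rnorm z <= 1 / 2 -> quasi_invertible mul z.
Proof.
move=> z2; apply: (@neumann _ 1) => n; rewrite mul1r.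
elim: n => [|n IH] /=; first by rewrite expr0; lra.
apply: le_trans (ler_rnormM _ _) _; rewrite exprSr mul1r in z2 *.
by apply: ler_pM => //; exact: rnorm_ge0.
Qed.

(* In the unitization, 1 - circ x y = (1 - x)(1 - y). *)
Definition circ x y := x + y - x ** y.

Lemma circA x y z : circ x (circ y z) = circ (circ x y) z.
Proof. by rewrite /circ !bmulE bmulA; abel. Qed.

Lemma circ0l x : circ 0 x = x. Proof. by rewrite /circ bmul0l; abel. Qed.
Lemma circ0r x : circ x 0 = x. Proof. by rewrite /circ bmul0r; abel. Qed.

Lemma quasi_invertibleP x y z : circ y x = 0 -> circ x z = 0 -> quasi_invertible mul x.
Proof.
move=> yx xz; have yz : y = z by rewrite -[y]circ0r -xz circA yx circ0l.
by exists y; split; [rewrite yz|rewrite -yx /circ; abel].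
Qed.

(** * Multipliers: right multiplications by elements of the unitization, encoded as pairs *)

Definition rmop (p : R[i] * V) x := p.1 *: x + x ** p.2.

Lemma rmop_pair l a x : rmop (l, a) x = l *: x + x ** a.
Proof. by []. Qed.

(** The product q p in the unitization, as right multiplications compose in reverse order. *)
Definition rcomp (p q : R[i] * V) : R[i] * V :=
  (p.1 * q.1, p.1 *: q.2 + q.1 *: p.2 + q.2 ** p.2).

Lemma rmop_comp p q x : rmop (rcomp p q) x = rmop p (rmop q x).
Proof.
rewrite /rmop /= !bmulE !scalerDr !scalerA (bmulA x q.2); abel.
Qed.

Lemma rmopD p x y : rmop p (x + y) = rmop p x + rmop p y.
Proof. by rewrite /rmop bmulE scalerDr; abel. Qed.

Lemma rmopZ p (l : R[i]) x : rmop p (l *: x) = l *: rmop p x.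
Proof. by rewrite /rmop bmulE scalerDr !scalerA mulrC. Qed.

Lemma rmopN p x : rmop p (- x) = - rmop p x.
Proof. by rewrite -scaleN1r rmopZ scaleN1r. Qed.

Lemma rmopB p x y : rmop p (x - y) = rmop p x - rmop p y.
Proof. by rewrite rmopD rmopN. Qed.

Lemma mul_rmop p x y : x ** rmop p y = rmop p (x ** y).
Proof. by rewrite /rmop !bmulE bmulA. Qed.

Definition rbound (p : R[i] * V) := Normc.normc p.1 + rnorm p.2.

Lemma rbound_ge0 p : 0 <= rbound p.
Proof. by rewrite addr_ge0 ?normc_ge0 ?rnorm_ge0. Qed.

Lemma rmop_bound p x : rnorm (rmop p x) <= rbound p * rnorm x.
Proof.
apply: le_trans (ler_rnormD _ _) _; rewrite mulrDl rnormZ lerD2l.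
by rewrite mulrC; exact: ler_rnormM.
Qed.

(** * The derivation, its separating space and minimal multipliers *)

Variable d : V -> V.
Hypothesis rad_rann : jacobson_radical mul = right_annihilator mul.
Hypothesis comm_mod_rad : forall a b, jacobson_radical mul (a ** b - b ** a).
Hypothesis der : derivation mul d.

Let linD : forall (l : R[i]) a b, d (l *: a + b) = l *: d a + d b.
Proof. by case: der. Qed.

Let dM a b : d (a ** b) = d a ** b + a ** d b.
Proof. by case: der. Qed.

Let d0 : d 0 = 0.
Proof. by have := linD 1 0 0; rewrite !scale1r addr0 -[LHS]addr0 => /addrI. Qed.

Let dZ l a : d (l *: a) = l *: d a.
Proof. by have := linD l a 0; rewrite d0 !addr0. Qed.

Let dD a b : d (a + b) = d a + d b.
Proof. by have := linD 1 a b; rewrite !scale1r. Qed.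

Let dN a : d (- a) = - d a.
Proof. by rewrite -scaleN1r dZ scaleN1r. Qed.

Local Notation I := (right_annihilator mul).
Local Notation S := (separating d).

(** The commutator of b and c lies in the radical, so a annihilates it from the left. *)
Lemma bmulAC a b c : a ** b ** c = a ** c ** b.
Proof.
have := comm_mod_rad b c; rewrite rad_rann => /(_ a).
by rewrite bmulDr bmulNr => /eqP; rewrite subr_eq0 !bmulA => /eqP.
Qed.

Lemma rmopC p q x : rmop p (rmop q x) = rmop q (rmop p x).
Proof.
rewrite /rmop !bmulE !scalerDr !scalerA (mulrC p.1) (bmulAC x q.2). abel.
Qed.

Lemma d_rmop p x : d (rmop p x) = rmop p (d x) + x ** d p.2.
Proof. by rewrite /rmop dD dZ dM; abel. Qed.

(** By [d_rmop], d commutes with the multiplier up to a bounded term, so boundedness of d modulo S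
    carries over. *)
Lemma d_rmop_bounded p : exists C, 0 <= C /\ forall x, exists s, S s /\
  rnorm (d (rmop p x) - rmop p s) <= C * rnorm x.
Proof.
have [C [C0 hC]] := closed_graph_mod_separating linD.
exists (rbound p * C + rnorm (d p.2)); split.
  by rewrite addr_ge0 ?mulr_ge0 ?rbound_ge0 ?rnorm_ge0.
move=> x; have [s [Ss hs]] := hC x; exists s; split=> //.
rewrite d_rmop addrAC -rmopB mulrDl -mulrA.
apply: le_trans (ler_rnormD _ _) _; apply: lerD; last first.
  by rewrite mulrC; exact: ler_rnormM.
apply: le_trans (rmop_bound _ _) _; rewrite ler_wpM2l // rbound_ge0 //.
Qed.

(** A tiny x with d x near s has d (p x) near p s, hence far from q S; scaling x up by c makes the
    distance as large as required. *)
Lemma d_rmop_large p q s e : S s -> 0 < e ->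
  (forall s', S s' -> e <= rnorm (rmop p s - rmop q s')) ->
  forall K h, 0 < h -> exists x, rnorm x <= h /\
    forall s', S s' -> K <= rnorm (d (rmop p x) - rmop q s').
Proof.
move=> Ss e0 far K h h0; pose c := 2 * `|K| / e + 1.
have c0 : 0 < c by rewrite ltr_wpDl // divr_ge0 ?mulr_ge0 // ltW.
pose B := rbound p + rnorm (d p.2).
have B0 : 0 <= B by rewrite addr_ge0 ?rbound_ge0 ?rnorm_ge0.
(* The first bound keeps c x below h, the second makes the error between d (p x) and p s at most
   e/2. *)
have t0 : 0 < Num.min (h / c) (e / (2 * (B + 1))).
  by rewrite lt_min !divr_gt0 // mulr_gt0 // ltr_wpDl.
have [x [+ +]] := Ss _ t0; rewrite !lt_min => /andP[x1 x2] /andP[_ x3].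
have close : rnorm (d (rmop p x) - rmop p s) <= e / 2.
  rewrite d_rmop addrAC -rmopB; apply: le_trans (ler_rnormD _ _) _.
  have h1 := rmop_bound p (d x - s); have h2 := ler_rnormM x (d p.2).
  set T := e / (2 * (B + 1)) in x2 x3.
  have h3 : rbound p * rnorm (d x - s) <= rbound p * T.
    by rewrite ler_wpM2l ?rbound_ge0 // ltW.
  have h4 : rnorm x * rnorm (d p.2) <= T * rnorm (d p.2).
    by rewrite ler_wpM2r ?rnorm_ge0 // ltW.
  have h5 : B * T <= e / 2.
    have -> : B * T = (B / (B + 1)) * (e / 2).
      by rewrite /T; field; rewrite gt_eqF // ltr_wpDl.
    by rewrite ler_piMl ?ler_pdivrMr ?ltr_wpDl //; lra.
  by move: h5; rewrite [B]/(rbound p + rnorm (d p.2)) mulrDl; lra.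
exists (c%:C%C *: x); split.
  by rewrite (rnormZr _ (ltW c0)) mulrC -ler_pdivlMr // ltW.
move=> s' Ss'; have [s1 [-> Ss1]] : exists s1, s' = c%:C%C *: s1 /\ S s1.
  exists (c^-1%:C%C *: s'); split; last exact: separatingZ.
  by rewrite scalerA -rmorphM /= divff ?gt_eqF // scale1r.
rewrite !rmopZ dZ -scalerBr (rnormZr _ (ltW c0)); have := far s1 Ss1.
have := ler_rdist (rmop p s) (d (rmop p x)) (rmop q s1); rewrite (rnormB _ (d (rmop p x))).
move=> h1 h2; have h3 : e / 2 <= rnorm (d (rmop p x) - rmop q s1) by lra.
apply: le_trans (ler_norm K) _.
apply: (@le_trans _ _ (c * (e / 2))); last by rewrite ler_pM2l.
rewrite /c mulrDl mul1r; have -> : 2 * `|K| / e * (e / 2) = `|K| by field; rewrite gt_eqF.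
by lra.
Qed.

(* Gliding hump: if the images of S under some products of contractions could
   decrease strictly forever, d would be infinite at a suitable series. *)
Lemma no_descending_multipliers (P : nat -> R[i] * V) (q : nat -> R[i] * V) :
  P 0%N = (1, 0) -> (forall n, P n.+1 = rcomp (q n) (P n)) ->
  (forall n x, rnorm (rmop (q n) x) <= rnorm x) ->
  ~ (forall n, exists s e, [/\ S s, 0 < e &
       forall s', S s' -> e <= rnorm (rmop (P n) s - rmop (P n.+1) s')]).
Proof.
move=> P0 PS qc far.
have /choice[C hC] := fun n => d_rmop_bounded (P n).
have /choice[X hX] : forall a : nat * R, exists x, rnorm x <= 2^-1 ^+ a.1 /\
    forall s', S s' -> a.2 <= rnorm (d (rmop (P a.1) x) - rmop (P a.1.+1) s').
  move=> [n K]; have [s [e [Ss e0 hs]]] := far n.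
  apply: (d_rmop_large Ss e0 hs); rewrite exprn_gt0 // invr_gt0 //.
(* The n-th hump must exceed n plus the contributions of the later terms (norm at most 2, constant
   [C n.+1]) and of the earlier sum y. *)
pose bnd n y := n%:R + 2 * C n.+1 + rnorm (d y).
pose s n := iteri n (fun k y => y + rmop (P k) (X (k, bnd k y))) 0.
pose x n := X (n, bnd n (s n)).
have sS n : s n.+1 = s n + rmop (P n) (x n) by [].
(* These are the partial sums of the series left after factoring out [P n]; their limit [Z n]
   satisfies Z 0 = s n + P n (Z n). *)
pose tail := fix tail (k n : nat) {struct k} : V :=
  if k is k'.+1 then x n + rmop (q n) (tail k' n.+1) else 0.
have tailS k n : tail k.+1 n = x n + rmop (q n) (tail k n.+1) by [].
have tail_diff k n : rnorm (tail k.+1 n - tail k n) <= 2^-1 ^+ n * 2^-1 ^+ k.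
  elim: k n => [|k IH] n.
    rewrite tailS /tail /rmop bmul0l scaler0 !addr0 subr0 expr0 mulr1.
    by have [] := hX (n, bnd n (s n)).
  rewrite tailS (tailS k) opprD addrACA subrr add0r -rmopB.
  apply: le_trans (qc _ _) _; apply: le_trans (IH _) _.
  by rewrite !exprS mulrA (mulrC (_ ^+ n)).
have /choice[Z hZ] : forall n, exists z, forall k,
    rnorm (z - tail k n) <= 2 * 2^-1 ^+ n * 2^-1 ^+ k.
  by move=> n; apply: geo_cvg => k; exact: tail_diff.
have ZE n : Z n = x n + rmop (q n) (Z n.+1).
  apply/eqP; rewrite -subr_eq0; apply/eqP.
  apply: (@geo_eq0 _ (2 * 2^-1 ^+ n + 2 * 2^-1 ^+ n.+1)) => k.
  have -> : Z n - (x n + rmop (q n) (Z n.+1)) =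
      (Z n - tail k.+1 n) - rmop (q n) (Z n.+1 - tail k n.+1).
    by rewrite tailS rmopB; abel.
  apply: le_trans (ler_rnormB _ _) _; rewrite mulrDl; apply: lerD.
    apply: le_trans (hZ _ _) _; rewrite ler_wpM2l ?mulr_ge0 ?exprn_ge0 ?invr_ge0 //.
    by rewrite exprS ler_piMl ?exprn_ge0 ?invr_ge0 // invf_le1 // ler1n.
  exact: le_trans (qc _ _) (hZ _ _).
have Z_le2 n : rnorm (Z n) <= 2.
  have := hZ n 0%N; rewrite subr0 expr0 mulr1 => /le_trans; apply.
  by rewrite ler_piMr // exprn_ile1 ?invr_ge0 // invf_le1 // ler1n.
have split n : Z 0%N = s n + rmop (P n) (Z n).
  elim: n => [|n IH]; first by rewrite P0 /rmop /= bmul0r scale1r addr0 add0r.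
  rewrite sS {}IH {1}(ZE n) rmopD PS rmop_comp (rmopC (q n)); abel.
(* For this n the hump at stage n would force n <= rnorm (d (Z 0)). *)
pose n := (Num.trunc (rnorm (d (Z 0%N)))).+1.
have hn : rnorm (d (Z 0%N)) < n%:R by exact: truncnS_gt.
have [C0 /(_ (Z n.+1))[s' [Ss' hs']]] := hC n.+1.
have [_ /(_ (- s') (separatingN linD Ss'))] := hX (n, bnd n (s n)).
rewrite /= -/(x n) /bnd rmopN opprK.
have -> : d (rmop (P n) (x n)) + rmop (P n.+1) s' =
    d (Z 0%N) - d (s n) - (d (rmop (P n.+1) (Z n.+1)) - rmop (P n.+1) s').
  by rewrite (split n.+1) sS !dD; abel.
have := ler_rnormB (d (Z 0%N) - d (s n)) (d (rmop (P n.+1) (Z n.+1)) - rmop (P n.+1) s').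
have := ler_rnormB (d (Z 0%N)) (d (s n)).
have : C n.+1 * rnorm (Z n.+1) <= C n.+1 * 2 by exact: ler_wpM2l.
by lra.
Qed.

Definition minimal p := forall q, (forall s, S s -> I (rmop q (rmop p s))) \/
  (forall s e, S s -> 0 < e -> exists s', S s' /\
     rnorm (rmop p s - rmop q (rmop p s')) < e).

(** If no multiplier were minimal, each p with p S outside the radical would admit a q shrinking p S
    strictly; iteration contradicts [no_descending_multipliers]. *)
Lemma minimal_multiplier : (exists s, S s /\ ~ I s) ->
  exists p, (exists s, S s /\ ~ I (rmop p s)) /\ minimal p.
Proof.
move=> nontriv; apply: contrapT => nomin.
pose good p := exists s, S s /\ ~ I (rmop p s).
have /choice[f hf] : forall p, exists q, good p ->
    [/\ forall x, rnorm (rmop q x) <= rnorm x, good (rcomp q p) &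
     exists s e, [/\ S s, 0 < e &
       forall s', S s' -> e <= rnorm (rmop p s - rmop (rcomp q p) s')]].
  move=> p; have [gp|] := pselect (good p); last by exists p.
  have [q [/existsNP[s1 /not_implyP[Ss1 Is1]] hq]] : exists q,
      ~ (forall s, S s -> I (rmop q (rmop p s))) /\
      ~ (forall s e, S s -> 0 < e -> exists s', S s' /\
           rnorm (rmop p s - rmop q (rmop p s')) < e).
    apply: contrapT => noq; apply: nomin; exists p; split=> // q.
    by apply: contrapT => /not_orP hq; apply: noq; exists q.
  (* Dividing q by c makes it a contraction and leaves the images of S unchanged. *)
  pose c := rbound q + 1; have c0 : 0 < c by rewrite ltr_wpDl // rbound_ge0.
  pose q' := (c^-1%:C%C * q.1, c^-1%:C%C *: q.2).
  have q'E x : rmop q' x = c^-1%:C%C *: rmop q x.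
    by rewrite /rmop /= bmulZr scalerDr scalerA.
  have ci0 : 0 <= c^-1 by rewrite invr_ge0 ltW.
  exists q' => _; split.
  - move=> x; rewrite q'E rnormZr // mulrC ler_pdivrMr //.
    apply: le_trans (rmop_bound _ _) _; rewrite mulrC ler_wpM2l ?rnorm_ge0 //.
    by rewrite /c lerDl.
  - exists s1; split=> // h; apply: Is1 => a; move: (h a).
    rewrite rmop_comp q'E bmulZr => /eqP; rewrite scaler_eq0.
    by rewrite (inj_eq (@complexI R)) gt_eqF ?invr_gt0 // => /eqP.
  move: hq => /existsNP[s /existsNP[e /not_implyP[Ss /not_implyP[e0 hs]]]].
  exists s, e; split=> // s' Ss'; rewrite leNgt; apply/negP => le; apply: hs.
  exists (c^-1%:C%C *: s'); split; first exact: separatingZ.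
  by move: le; rewrite rmop_comp q'E !rmopZ.
pose P n := iteri n (fun _ p => rcomp (f p) p) (1, 0).
have gP n : good (P n).
  elim: n => [|n /hf[]//]; case: nontriv => s [Ss Is]; exists s; split=> //.
  by rewrite /rmop /= bmul0r scale1r addr0.
apply: (@no_descending_multipliers P (f \o P)) => // n.
- by move=> x; have [+ _ _] := hf _ (gP n); exact.
- by have [_ _] := hf _ (gP n).
Qed.

(** * Ideal properties and an idempotent in the separating space *)

Lemma rannD x y : I x -> I y -> I (x + y).
Proof. by move=> Ix Iy a; rewrite bmulDr Ix Iy addr0. Qed.

Lemma rannN x : I x -> I (- x).
Proof. by move=> Ix a; rewrite bmulNr Ix oppr0. Qed.

Lemma rann_mulr x y : I x -> I (x ** y).
Proof. by move=> Ix a; rewrite -bmulA Ix bmul0l. Qed.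

Lemma rann_quasi_invertible x : I x -> quasi_invertible mul x.
Proof. by rewrite -rad_rann => /(_ 1 0); rewrite scale1r bmul0l addr0. Qed.

Lemma separating_mull a s : S s -> S (a ** s).
Proof.
move=> Ss e e0; pose B := rnorm a + rnorm (d a) + 1.
have a0 := rnorm_ge0 a; have da0 := rnorm_ge0 (d a).
have B0 : 0 < B by rewrite ltr_wpDl // addr_ge0.
have [|x []] := Ss (e / (2 * B)); first by rewrite divr_gt0 // mulr_gt0.
rewrite !ltr_pdivlMr ?mulr_gt0 // /B => x1 x2; exists (a ** x).
have x0 := rnorm_ge0 x; have dx0 := rnorm_ge0 (d x - s); split.
  by have := ler_rnormM a x; nra.
have -> : d (a ** x) - a ** s = d a ** x + a ** (d x - s).
  by rewrite dM bmulDr bmulNr; abel.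
have := ler_rnormD (d a ** x) (a ** (d x - s)).
by have := ler_rnormM (d a) x; have := ler_rnormM a (d x - s); nra.
Qed.

Lemma separating_mulr a s : S s -> S (s ** a).
Proof.
move=> Ss e e0; pose B := rnorm a + rnorm (d a) + 1.
have a0 := rnorm_ge0 a; have da0 := rnorm_ge0 (d a).
have B0 : 0 < B by rewrite ltr_wpDl // addr_ge0.
have [|x []] := Ss (e / (2 * B)); first by rewrite divr_gt0 // mulr_gt0.
rewrite !ltr_pdivlMr ?mulr_gt0 // /B => x1 x2; exists (x ** a).
have x0 := rnorm_ge0 x; have dx0 := rnorm_ge0 (d x - s); split.
  by have := ler_rnormM x a; nra.
have -> : d (x ** a) - s ** a = (d x - s) ** a + x ** d a.
  by rewrite dM bmulDl bmulNl; abel.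
have := ler_rnormD ((d x - s) ** a) (x ** d a).
by have := ler_rnormM x (d a); have := ler_rnormM (d x - s) a; nra.
Qed.

Lemma separating_rmop p s : S s -> S (rmop p s).
Proof.
move=> Ss; apply: (separatingD linD); first exact: (separatingZ linD).
exact: separating_mulr.
Qed.

Lemma minimal_idempotent p : minimal p -> (exists s, S s /\ ~ I (rmop p s)) ->
  exists s, [/\ S s, rmop p s != 0 & rmop p s ** rmop p s = rmop p s].
Proof.
move=> pmin [s0 [Ss0 It]].
have [l [a nqi]] : exists l a, ~ quasi_invertible mul (l *: rmop p s0 + a ** rmop p s0).
  apply: contrapT => all_qi; apply: It; rewrite -rad_rann => l a.
  by apply: contrapT => nqi; apply: all_qi; exists l, a.
pose s1 := l *: s0 + a ** s0.
have Ss1 : S s1.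
  by apply: (separatingD linD); [exact: (separatingZ linD)|exact: separating_mull].
have : ~ quasi_invertible mul (rmop p s1) by rewrite rmopD rmopZ -mul_rmop.
move eb : (rmop p s1) => b {}nqi.
(* The multiplier is x - x b. If it sends p S into the radical, b is idempotent modulo I, and b b is
   exactly idempotent because c b = c b b for every c. *)
have [idb|dense] := pmin (1, - b).
  have bb c : c ** b = c ** (b ** b).
    have := idb s1 Ss1 c; rewrite eb rmop_pair scale1r !bmulE => /eqP.
    by rewrite subr_eq0 => /eqP.
  exists (b ** s1); rewrite -mul_rmop eb; split; first exact: separating_mull.
    apply/eqP => b0; apply: nqi; apply: rann_quasi_invertible => c.
    by rewrite bb b0 bmul0r.
  by rewrite -bb bmulA -bb.
have e0 : 0 < (1 / 2 : R) by lra.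
have [s' [Ss']] := dense s1 _ Ss1 e0; rewrite eb; move: (rmop p s') => t hs'.
have [w [_ hw]] := neumann_half (ltW hs').
(* The small element is [circ (- t) b] with quasi-inverse w, so by associativity y is a left
   quasi-inverse of b. *)
pose y := circ w (- t).
have yb : circ y b = 0.
  rewrite /y -circA -hw rmop_pair /circ !bmulE !scale1r; abel.
(* As [circ y b] is 0, [circ b y] is a commutator, hence in the radical; correcting y by i gives a
   right quasi-inverse. *)
have [i [hi _]] : quasi_invertible mul (circ b y).
  apply: rann_quasi_invertible; rewrite -rad_rann.
  have -> : circ b y = y ** b - b ** y; last exact: comm_mod_rad.
  by rewrite -[RHS]addr0 -yb /circ; abel.
case: nqi; apply: (quasi_invertibleP yb (z := circ y i)).
by rewrite circA.
Qed.

(** * The corner of an idempotent and the Gelfand-Mazur theorem *)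

Section Corner.
Variable e : V.
Hypotheses (ee : e ** e = e) (e_neq0 : e != 0).

Definition corner_pred : {pred V} := fun x => e ** x == x.

Fact corner_zmod : zmod_closed corner_pred.
Proof.
split=> [|x y]; first by rewrite unfold_in bmul0r.
by rewrite !unfold_in bmulDr bmulNr => /eqP-> /eqP->.
Qed.
HB.instance Definition _ := GRing.isZmodClosed.Build V corner_pred corner_zmod.

(* The corner e V is a commutative unital algebra without any quotient: in V
   itself a b c = a c b, so that left multiplication by e kills commutators. *)
Record corner := Corner { corner_val :> V; _ : corner_val \in corner_pred }.
HB.instance Definition _ := [isSub for corner_val].
HB.instance Definition _ := [Choice of corner by <:].
HB.instance Definition _ := [SubChoice_isSubZmodule of corner by <:].

Lemma cornerE (x : corner) : e ** x = x.
Proof. by case: x => x /=; rewrite unfold_in => /eqP. Qed.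

Fact corner_mul_subproof (x y : corner) : x ** y \in corner_pred.
Proof. by rewrite unfold_in -bmulA cornerE. Qed.
Definition corner_mul x y := Corner (corner_mul_subproof x y).

Fact corner_scalar_subproof (l : R[i]) : l *: e \in corner_pred.
Proof. by rewrite unfold_in bmulZr ee. Qed.
Definition corner_scalar l := Corner (corner_scalar_subproof l).

Fact corner_mulA : associative corner_mul.
Proof. by move=> x y z; apply: val_inj; rewrite /= bmulA. Qed.
Fact corner_mulC : commutative corner_mul.
Proof.
by move=> x y; apply: val_inj; rewrite /= -[in LHS](cornerE x) -[in RHS](cornerE y) bmulAC.
Qed.
Fact corner_mul1 : left_id (corner_scalar 1) corner_mul.
Proof. by move=> x; apply: val_inj; rewrite /= scale1r cornerE. Qed.
Fact corner_mulDl : left_distributive corner_mul +%R.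
Proof. by move=> x y z; apply: val_inj; rewrite /= bmulDl. Qed.
Fact corner_1neq0 : corner_scalar 1 != 0.
Proof. by rewrite -val_eqE /= scale1r. Qed.
HB.instance Definition _ := GRing.Zmodule_isComNzRing.Build corner
  corner_mulA corner_mulC corner_mul1 corner_mulDl corner_1neq0.

Fact corner_scalar_zmod : zmod_morphism corner_scalar.
Proof. by move=> l m; apply: val_inj; rewrite /= scalerBl. Qed.
Fact corner_scalar_monoid : monoid_morphism corner_scalar.
Proof.
by split=> // l m; apply: val_inj; rewrite /= bmulZl bmulZr ee scalerA.
Qed.
HB.instance Definition _ :=
  GRing.isZmodMorphism.Build R[i] corner corner_scalar corner_scalar_zmod.
HB.instance Definition _ :=
  GRing.isMonoidMorphism.Build R[i] corner corner_scalar corner_scalar_monoid.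

(** Otherwise b = e x has an inverse g in the corner and every 1 - l g is invertible. Then g has
    spectral radius 0, against N 1 <= N(b)^n N(g^n). *)
Lemma corner_gelfand_mazur x : exists l : R[i], forall y, y ** (e ** x - l *: e) <> e.
Proof.
apply: contrapT => noninv.
have in_corner y : e ** y \in corner_pred by rewrite unfold_in -bmulA ee.
pose b := Corner (in_corner x).
have inv l : exists y : corner, y * (b - corner_scalar l) = 1.
  have [y hy] : exists y, y ** (e ** x - l *: e) = e.
    apply: contrapT => no; apply: noninv; exists l => y hy.
    by apply: no; exists y.
  exists (Corner (in_corner y)); apply: val_inj.
  by rewrite /= bmulA hy ee scale1r.
have [g hg] := inv 0; rewrite rmorph0 subr0 in hg.
have inv1 l : exists h, h * (1 - corner_scalar l * g) = 1.
  (* Since g b = 1, the element 1 - l g equals (b - l) g. *)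
  have [y hy] := inv l; exists (y * b).
  have -> : y * b * (1 - corner_scalar l * g) =
    y * b - y * corner_scalar l * (g * b) by ring.
  by rewrite hg mulr1 -mulrBr.
pose N (z : corner) := rnorm (z : V).
have NM z w : N (z * w) <= N z * N w by exact: ler_rnormM.
have N1 : 0 < N 1.
  rewrite lt_neqAle rnorm_ge0 andbT eq_sym; apply/eqP => /rnorm_eq0 /=.
  by rewrite scale1r => /eqP; rewrite (negbTE e_neq0).
have N0 z : 0 <= N z by exact: rnorm_ge0.
have ND z w : N (z + w) <= N z + N w by exact: ler_rnormD.
have Nscale l z : N (corner_scalar l * z) = Normc.normc l * N z.
  by rewrite /N /= bmulZl cornerE rnormZ.
have [M /(_ M (leqnn M))] := spectral_radius_eq0 N0 ND NM Nscale inv1 (N0 b) N1.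
apply/negP; rewrite -leNgt.
have -> : N 1 = N (b ^+ (2 ^ M) * g ^+ (2 ^ M)) by rewrite -exprMn mulrC hg expr1n.
apply: le_trans (NM _ _) _; rewrite ler_wpM2r //.
have : (0 < 2 ^ M)%N by rewrite expn_gt0.
case: (2 ^ M)%N => // k _; elim: k => [|k IH]; first by rewrite !expr1.
by rewrite exprS [leRHS]exprS; apply: le_trans (NM _ _) _; rewrite ler_wpM2l.
Qed.

End Corner.

(** * The separating space lies in the radical *)

Lemma minimal_corner_scalar p s : minimal p -> S s -> rmop p s != 0 ->
  rmop p s ** rmop p s = rmop p s ->
  forall x, exists l : R[i], rmop p s ** x = l *: rmop p s.
Proof.
move=> pmin Ss; move es : (rmop p s) => e e0 ee x.
have [l hl] := corner_gelfand_mazur ee e0 x; exists l.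
(* The multiplier is right multiplication by x - l. If it sends p S into I, multiplying by e gives e
   x = l e; if the image is dense, e x - l e becomes left invertible. *)
have [hI|dense] := pmin (- l, x).
  have := hI s Ss e; rewrite es rmop_pair !bmulE -bmulA ee scaleNr addrC => /eqP.
  by rewrite subr_eq0 => /eqP.
exfalso; have n0 := rnorm_ge0 e.
have h0 : 0 < 1 / (2 * (rnorm e + 1)) by rewrite divr_gt0 // mulr_gt0 // ltr_wpDl.
have [s' [_]] := dense s _ Ss h0; rewrite es; move: (rmop p s') => t.
move vE : (e - _) => v hv.
have [|u [hu1 hu2]] := @neumann_half (e ** v).
  apply: le_trans (ler_rnormM _ _) _; move: hv.
  by rewrite ltr_pdivlMr ?mulr_gt0 ?ltr_wpDl // => hv; have := rnorm_ge0 v; nra.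
(* Since (e t)(e x - l e) = e - e v, the factor e - u built from the quasi-inverse u of e v
   completes the left inverse. *)
apply: (hl (e ** (e - u) ** (e ** t))).
have -> : e ** (e - u) ** (e ** t) ** (e ** x - l *: e) = e ** (e - u) ** (e - e ** v).
  rewrite bmulA; congr (_ ** _).
  rewrite -vE rmop_pair !bmulE ee -!bmulA (bmulAC e t e) ee scaleNr; abel.
transitivity (e - e ** (e ** v + u - u ** (e ** v))); last by rewrite hu2 bmul0r subr0.
rewrite !bmulE -!bmulA (bmulAC e u e) !ee; abel.
Qed.

Lemma separating_sub_rann s : S s -> I s.
Proof.
move=> Ss; apply: contrapT => Is.
have [|p [good pmin]] := minimal_multiplier; first by exists s.
have [s1 [Ss1 e0 ee]] := minimal_idempotent pmin good.
have scal := minimal_corner_scalar pmin Ss1 e0 ee.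
have Se : S (rmop p s1) by exact: separating_rmop.
move: (rmop p s1) Se e0 ee scal => e Se e0 ee scal.
(* Multiplying the Leibniz rule for e e by e on the left gives e d e = 2 e d e, because e (d e) e =
   e d e. *)
have ede : e ** d e = 0.
  have := congr1 (mul e) (dM e e); rewrite ee bmulDr -!bmulA bmulAC ee.
  by move=> /eqP; rewrite -subr_eq0 opprD addNKr oppr_eq0 => /eqP.
have ed x : e ** d x = 0.
  have [l hl] := scal x; have := congr1 (mul e) (dM e x).
  by rewrite hl dZ bmulZr bmulDr -!bmulA ede ee bmul0l scaler0 add0r.
move/eqP: e0; apply; apply: rnorm_small_eq0 => h h0.
have n0 := rnorm_ge0 e.
have h0' : 0 < h / (rnorm e + 1) by rewrite divr_gt0 // ltr_wpDl.
have [x [_]] := Se _ h0'; rewrite ltr_pdivlMr ?ltr_wpDl // => hx.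
(* As e d x = 0, approximating e by values d x makes e = e e arbitrarily small. *)
have -> : e = - (e ** (d x - e)) by rewrite bmulDr bmulNr ed ee add0r opprK.
rewrite rnormN; apply: le_trans (ler_rnormM _ _) _.
by have := rnorm_ge0 (d x - e); nra.
Qed.

(** Since S lies in I and d maps I into itself, the closed graph bound can be iterated modulo I. *)
Lemma d_bounded_mod_rann : exists C, 0 <= C /\ forall n x,
  exists u, I (iter n d x - u) /\ rnorm u <= C ^+ n * rnorm x.
Proof.
have [C [C0 hC]] := closed_graph_mod_separating linD; exists C; split=> // n x.
have dI y : I y -> I (d y).
  by move=> Iy a; have := dM a y; rewrite !Iy d0 add0r => <-.
elim: n => [|n [u [Iu hu]]].
  by exists x; rewrite subrr expr0 mul1r; split=> // a; rewrite bmul0r.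
have [s [/separating_sub_rann Is hs]] := hC u.
exists (d u - s); split; last by rewrite exprS -mulrA (le_trans hs) // ler_wpM2l.
have -> : iter n.+1 d x - (d u - s) = d (iter n d x - u) + s by rewrite dD dN /=; abel.
exact: rannD (dI _ Iu) Is.
Qed.

(** * Iterated commutators and the Kleinecke-Shirokov argument *)

Section KleineckeShirokov.
Variable c : V.

(* adiv n k is the k-fold commutator of d^n with the right multiplication by c. *)
Fixpoint adiv n k x :=
  if k is k'.+1 then adiv n k' (x ** c) - adiv n k' x ** c else iter n d x.

(** The commutator of d with right multiplication by c is right multiplication by d c, which
    commutes with all right multiplications. At k = 0 the value of [k.-1] is harmless, as the
    coefficient vanishes. *)
Lemma adivS n k x :
  adiv n.+1 k x = d (adiv n k x) + (k%:R : R[i]) *: (adiv n k.-1 x ** d c).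
Proof.
elim: k x => [|k IH] x; first by rewrite scale0r addr0.
rewrite [LHS]/= !IH; have -> : d (adiv n k.+1 x) =
    d (adiv n k (x ** c)) - d (adiv n k x) ** c - adiv n k x ** d c.
  by rewrite /= dD dN dM; abel.
rewrite !bmulE -natr1 scalerDl scale1r /=.
case: k IH => [|k] _ /=; first by rewrite !scale0r; abel.
rewrite !bmulE (bmulAC _ c (d c)) !scalerDr !scalerN; abel.
Qed.

Lemma iter_mulr n x : iter n (mul^~ (d c)) (x ** c) = iter n (mul^~ (d c)) x ** c.
Proof. by elim: n => //= n ->; rewrite bmulAC. Qed.

(** The two claims feed each other: the n-th diagonal term commutes with right multiplication by c,
    so the next commutator is 0, and [adivS] then gives the next diagonal term. *)
Lemma adiv_diag n x :
  adiv n n x = (n`!%:R : R[i]) *: iter n (mul^~ (d c)) x /\ adiv n n.+1 x = 0.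
Proof.
suff diag m : (forall y, adiv m m y = (m`!%:R : R[i]) *: iter m (mul^~ (d c)) y) ->
    forall y, adiv m m.+1 y = 0.
  have E : forall y, adiv n n y = (n`!%:R : R[i]) *: iter n (mul^~ (d c)) y.
    elim: n => [|n IH] y; first by rewrite fact0 scale1r.
    rewrite adivS (diag _ IH) d0 add0r [n.+1.-1]/= IH !bmulE scalerA -natrM.
    by rewrite factS.
  by split; [exact: E|exact: diag].
by move=> E y; rewrite /= !E iter_mulr bmulZl subrr.
Qed.

Lemma adiv_bound C n k x : 0 <= C ->
  (forall y, exists u, I (iter n d y - u) /\ rnorm u <= C ^+ n * rnorm y) ->
  exists u, I (adiv n k x - u) /\ rnorm u <= (2 * rnorm c) ^+ k * C ^+ n * rnorm x.
Proof.
move=> C0 hC; have c0 := rnorm_ge0 c; elim: k x => [|k IH] x.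
  by have [u hu] := hC x; exists u; rewrite expr0 mul1r.
have [u [Iu hu]] := IH (x ** c); have [v [Iv hv]] := IH x.
exists (u - v ** c); split.
  have -> : adiv n k.+1 x - (u - v ** c) =
      (adiv n k (x ** c) - u) + - ((adiv n k x - v) ** c).
    by rewrite /= bmulDl bmulNl; abel.
  by apply: rannD => //; apply: rannN; exact: rann_mulr.
apply: le_trans (ler_rnormB _ _) _; rewrite exprS; set A := _ ^+ k in hu hv *.
have h1 := ler_rnormM v c; have h2 := ler_rnormM x c.
have A0 : 0 <= A * C ^+ n by rewrite mulr_ge0 ?exprn_ge0 // mulr_ge0.
have h3 := ler_wpM2l A0 h2; have h4 := ler_wpM2r c0 hv; lra.
Qed.

(** Left multiplication by a kills I, turning the bound modulo I into a genuine one. *)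
Lemma mul_iter_bound C n a x : 0 <= C ->
  (forall y, exists u, I (iter n d y - u) /\ rnorm u <= C ^+ n * rnorm y) ->
  rnorm (a ** iter n (mul^~ (d c)) x) <=
    (2 * rnorm c * C) ^+ n / n`!%:R * (rnorm a * rnorm x).
Proof.
move=> C0 hC; have [u [Iu hu]] := adiv_bound n x C0 hC.
have f0 : 0 < n`!%:R :> R by rewrite ltr0n fact_gt0.
have E : (n`!%:R : R[i]) *: (a ** iter n (mul^~ (d c)) x) = a ** u.
  rewrite -bmulZr -(adiv_diag n x).1; apply/eqP; rewrite -subr_eq0.
  by rewrite -bmulNr -bmulDr Iu.
rewrite mulrAC ler_pdivlMr //.
have := congr1 (@rnorm R V) E; rewrite rnormZ normcMn Normc.normc1 => {}E.
rewrite mulrC E exprMn; apply: le_trans (ler_rnormM _ _) _.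
by rewrite mulrCA ler_wpM2l ?rnorm_ge0.
Qed.

End KleineckeShirokov.

Lemma derivation_rad c : jacobson_radical mul (d c).
Proof.
move=> l a; have [C [C0 hC]] := d_bounded_mod_rann.
set z := _ + _; pose p := (l, a).
(* Right multiplication by z is right multiplication by d c followed by the multiplier (l, a), and
   the two commute, so their iterates separate. *)
have zE x : x ** z = rmop p (x ** d c).
  by rewrite /z rmop_pair !bmulE -bmulA (bmulAC x a).
have iterE n x : iter n (mul^~ z) x = iter n (rmop p) (iter n (mul^~ (d c)) x).
  elim: n => //= n ->; rewrite zE; congr (rmop p _).
  elim: n (iter n _ x) => //= n IH y; rewrite -IH.
  by rewrite !rmop_pair !bmulE (bmulAC _ a).
have iter_mul n x y : x ** iter n (rmop p) y = iter n (rmop p) (x ** y).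
  by elim: n => //= n IH; rewrite mul_rmop IH.
have iter_le n x : rnorm (iter n (rmop p) x) <= rbound p ^+ n * rnorm x.
  elim: n => [|n IH]; first by rewrite mul1r.
  apply: le_trans (rmop_bound _ _) _; rewrite exprS -mulrA.
  by apply: ler_wpM2l; first exact: rbound_ge0.
(* The leading 2 is compensated by the factor 2^-n needed for [neumann]; T^n / n! is at most exp
   T. *)
pose T := 2 * rbound p * (2 * rnorm c * C).
have p0 := rbound_ge0 p; have c0 := rnorm_ge0 c.
have T0 : 0 <= T by rewrite !mulr_ge0.
have z0 := rnorm_ge0 z; pose A := expR T * (rnorm z * rnorm z).
have A0 : 0 <= A by rewrite !mulr_ge0 // expR_ge0.
(* The term [rnorm z] covers index 0, and 2 A absorbs the shift from n + 1 to n. *)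
apply: (@neumann _ (rnorm z + 2 * A)) => -[|n]; first by rewrite expr0 mulr1 /=; lra.
have h : rnorm (iter n.+1 (mul^~ z) z) <= A * 2^-1 ^+ n.
  (* One factor z is moved to the left, since the estimate holds only after a left
     multiplication. *)
  rewrite iterSr; have -> : iter n (mul^~ z) (z ** z) = z ** iter n (mul^~ z) z.
    by elim: n => //= n ->; rewrite bmulA.
  rewrite iterE iter_mul; apply: le_trans (iter_le _ _) _.
  apply: (@le_trans _ _ (rbound p ^+ n *
      ((2 * rnorm c * C) ^+ n / n`!%:R * (rnorm z * rnorm z)))).
    apply: ler_wpM2l; first exact: exprn_ge0.
    by apply: mul_iter_bound => // y; exact: hC.
  have -> : rbound p ^+ n * ((2 * rnorm c * C) ^+ n / n`!%:R * (rnorm z * rnorm z)) =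
      T ^+ n / n`!%:R * (rnorm z * rnorm z) * 2^-1 ^+ n.
    rewrite /T !exprMn exprVn; field.
    by rewrite pnatr_eq0 -lt0n fact_gt0 expf_neq0.
  apply: ler_wpM2r; first by rewrite exprn_ge0 // invr_ge0.
  apply: ler_wpM2r; first exact: mulr_ge0.
  case: n => [|n]; first by rewrite expr0 fact0 divr1 -expR0 ler_expR.
  by apply: le_trans (expR_ge1Dxn n T0); rewrite lerDr.
apply: le_trans h _; rewrite exprS.
have : 0 <= 2^-1 ^+ n :> R by rewrite exprn_ge0 // invr_ge0.
have := z0; move: A0; nra.
Qed.

End BanachAlgebra.

Theorem theorem3p2 (R : realType) (V : completeNormedModType R[i])
    (mul : V -> V -> V) (d : V -> V) :
  banach_algebra_mul mul ->
  jacobson_radical mul = right_annihilator mul ->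
  (forall a b, jacobson_radical mul (mul a b - mul b a)) ->
  derivation mul d ->
  forall a, jacobson_radical mul (d a).
Proof.
move=> ban rad_rann comm_mod_rad der a.
exact: (derivation_rad ban rad_rann comm_mod_rad der).
Qed.
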